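(* Let $(\mathcal C,\alpha)$ be a grading category and $A$ a $\mathcal C$-graded algebra. Then the bar construction $(\mathcal B(A),\partial)$ is a $\mathcal C$-graded DG-$(A,A)$-bimodule, with left action $$\rho_L(a,a_0\otimes a_1\otimes\cdots\otimes a_{n+1})=\Phi(|a|,|a_0|,\ldots,|a_{n+1}|)\,\mu_A(a,a_0)\otimes a_1\otimes\cdots\otimes a_{n+1}$$ and right action $$\rho_R(a_0\otimes a_1\otimes\cdots\otimes a_{n+1},a)=\Psi(|a_0|,\ldots,|a_{n+1}|,|a|)\,a_0\otimes a_1\otimes\cdots\otimes\mu_A(a_{n+1},a),$$ where $\Phi(|a|,|a_0|,\ldots,|a_{n+1}|)=\prod_{i=1}^{n+1}\alpha(|a|,|a_{i-1}|\circ\cdots\circ|a_0|,|a_i|)^{-1}$ and $\Psi(|a_0|,\ldots,|a_{n+1}|,|a|)=\alpha(|a_n|\circ\cdots\circ|a_0|,|a_{n+1}|,|a|)$.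
   Context: Let $\Bbbk$ be a commutative unital ring with unit group $\Bbbk^\times$ and $\mathcal C$ a small category. A grading category $(\mathcal C,\alpha)$: $\alpha$ assigns to each composable triple $(f_1,f_2,f_3)$ (so $f_3\circ f_2\circ f_1$ is defined) an element of $\Bbbk^\times$ such that for all composable $(f_1,f_2,f_3,f_4)$: $\alpha(f_1,f_2,f_3)\,\alpha(f_1,f_2,f_4\circ f_3)^{-1}\alpha(f_1,f_3\circ f_2,f_4)\,\alpha(f_2\circ f_1,f_3,f_4)^{-1}\alpha(f_2,f_3,f_4)=1$. A $\mathcal C$-graded module is a $\Bbbk$-module $M=\bigoplus_{g\in\mathrm{Mor}(\mathcal C)}M_g$; write $|x|=g$ for $x\in M_g$. Graded maps are $\Bbbk$-linear and preserve each $M_g$. $(M\otimes N)_g=\bigoplus_{g=g_2\circ g_1}M_{g_1}\otimes_\Bbbk N_{g_2}$ (products of elements with non-composable degrees are zero). Typical unitor constants (assumed): for $g:X\to Y$, $\mathcal L(\mathrm{Id}_X,g)=\alpha(\mathrm{Id}_X,\mathrm{Id}_X,g)^{-1}$, $\mathcal R(g,\mathrm{Id}_Y)=\alpha(g,\mathrm{Id}_Y,\mathrm{Id}_Y)$. A $\mathcal C$-graded algebra is a $\mathcal C$-graded module $A$ with a graded $\Bbbk$-linear $\mu_A:A\otimes A\to A$ (so $|\mu_A(x,y)|=|y|\circ|x|$) and elements $1_X\in A_{\mathrm{Id}_X}$ with, for homogeneous elements, $\mu_A(\mu_A(x,y),z)=\alpha(|x|,|y|,|z|)\mu_A(x,\mu_A(y,z))$,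 $\mu_A(1_X,x)=\mathcal L(\mathrm{Id}_X,|x|)x$, $\mu_A(x,1_Y)=\mathcal R(|x|,\mathrm{Id}_Y)x$ if $|x|:X\to Y$. A $\mathcal C$-graded $(A,B)$-bimodule is a $\mathcal C$-graded module $M$ with graded maps $\rho_L:A\otimes M\to M$, $\rho_R:M\otimes B\to M$ such that $\rho_L(\mu_A(a,a'),m)=\alpha(|a|,|a'|,|m|)\rho_L(a,\rho_L(a',m))$, $\rho_R(\rho_R(m,b),b')=\alpha(|m|,|b|,|b'|)\rho_R(m,\mu_B(b,b'))$, $\rho_R(\rho_L(a,m),b)=\alpha(|a|,|m|,|b|)\rho_L(a,\rho_R(m,b))$, $\rho_L(1_X,m)=\mathcal L(\mathrm{Id}_X,|m|)m$, $\rho_R(m,1_Y)=\mathcal R(|m|,\mathrm{Id}_Y)m$ for $|m|:X\to Y$. A $\mathcal C$-graded DG-$(A,B)$-bimodule is a $\mathcal C$-graded $(A,B)$-bimodule with an additional $\mathbb Z$-grading $M=\bigoplus_{n\in\mathbb Z,g}M_g^n$ (homological degree, preserved by the actions of $A$ and $B$) and a $\Bbbk$-linear $\partial_M:M\to M$ with $\partial_M(M_g^n)\subset M_g^{n-1}$, $\partial_M(\rho_L(a,m))=\rho_L(a,\partial_M(m))$, $\partial_M(\rho_R(m,b))=\rho_R(\partial_M(m),b)$, $\partial_M\circ\partial_M=0$. The bar construction $\mathcal B(A)$ is $A^{\otimes n+2}$ (parenthesized to the left) in homological degree $n\ge0$, with $\mathcal C$-degree $|a_{n+1}|\circ\cdots\circ|a_0|$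 on $a_0\otimes\cdots\otimes a_{n+1}$, and $\partial(a_0\otimes\cdots\otimes a_{n+1})=\sum_{i=0}^n(-1)^i\alpha(|a_{i-1}|\circ\cdots\circ|a_0|,|a_i|,|a_{i+1}|)\,a_0\otimes\cdots\otimes\mu_A(a_i,a_{i+1})\otimes\cdots\otimes a_{n+1}$ for $n\ge1$, where the $\alpha$-factor is $1$ for $i=0$ (and $\partial=0$ on $A^{\otimes2}$). *)

(* Defs.v *)
From HB Require Import structures.
From mathcomp Require Import all_boot all_order all_algebra.
From mathcomp Require Import boolp.

Set Implicit Arguments.
Unset Strict Implicit.
Unset Printing Implicit Defensive.

Import GRing.Theory.
Local Open Scope ring_scope.
Local Open Scope quotient_scope.

(* [comUnitRingType] would exclude the zero ring, so invertibility is carried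
   as data over a [comPzRingType]. *)
Record kunit (k : comPzRingType) := KUnit {
  uval : k;
  uinv : k;
  uvalK : uval * uinv = 1
}.

Section DirectSum.
Variables (k : comPzRingType) (I : choiceType) (M : I -> lmodType k).

Definition finsupp_fun (f : forall i, M i) : bool :=
  `[< exists s : seq I, forall i, i \notin s -> f i = 0 >].

Record dsum := DSum { dsum_fun :> forall i, M i; _ : finsupp_fun dsum_fun }.

HB.instance Definition _ := [isSub for dsum_fun].
HB.instance Definition _ := [Choice of dsum by <:].

Lemma dsumP (x y : dsum) : (forall i, x i = y i) -> x = y.
Proof. by move=> xy; apply/val_inj/functional_extensionality_dep. Qed.

Lemma dsum_finsupp (x : dsum) :
  exists s : seq I, forall i, i \notin s -> x i = 0.
Proof. by case: x => f /= /asboolP. Qed.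

Fact dsum_zero_subproof : finsupp_fun (fun i => 0 : M i).
Proof. by apply/asboolP; exists [::]. Qed.
Definition dsum_zero := DSum dsum_zero_subproof.

Fact dsum_add_subproof (x y : dsum) : finsupp_fun (fun i => x i + y i).
Proof.
apply/asboolP; have [s sP] := dsum_finsupp x; have [t tP] := dsum_finsupp y.
exists (s ++ t) => i; rewrite mem_cat negb_or => /andP[/sP-> /tP->].
by rewrite addr0.
Qed.
Definition dsum_add x y := DSum (dsum_add_subproof x y).

Fact dsum_opp_subproof (x : dsum) : finsupp_fun (fun i => - x i).
Proof.
apply/asboolP; have [s sP] := dsum_finsupp x; exists s => i /sP ->.
by rewrite oppr0.
Qed.
Definition dsum_opp x := DSum (dsum_opp_subproof x).

Fact dsum_scale_subproof (a : k) (x : dsum) : finsupp_fun (fun i => a *: x i).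
Proof.
apply/asboolP; have [s sP] := dsum_finsupp x; exists s => i /sP ->.
by rewrite scaler0.
Qed.
Definition dsum_scale a x := DSum (dsum_scale_subproof a x).

Fact dsum_addA : associative dsum_add.
Proof. by move=> x y z; apply: dsumP => i /=; rewrite addrA. Qed.
Fact dsum_addC : commutative dsum_add.
Proof. by move=> x y; apply: dsumP => i /=; rewrite addrC. Qed.
Fact dsum_add0 : left_id dsum_zero dsum_add.
Proof. by move=> x; apply: dsumP => i /=; rewrite add0r. Qed.
Fact dsum_addN : left_inverse dsum_zero dsum_opp dsum_add.
Proof. by move=> x; apply: dsumP => i /=; rewrite addNr. Qed.

HB.instance Definition _ :=
  GRing.isZmodule.Build dsum dsum_addA dsum_addC dsum_add0 dsum_addN.

Fact dsum_scaleA a b x : dsum_scale a (dsum_scale b x) = dsum_scale (a * b) x.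
Proof. by apply: dsumP => i /=; rewrite scalerA. Qed.
Fact dsum_scale1 : left_id 1 dsum_scale.
Proof. by move=> x; apply: dsumP => i /=; rewrite scale1r. Qed.
Fact dsum_scaleDr : right_distributive dsum_scale +%R.
Proof. by move=> a x y; apply: dsumP => i /=; rewrite scalerDr. Qed.
Fact dsum_scaleDl x : {morph dsum_scale^~ x : a b / a + b}.
Proof. by move=> a b; apply: dsumP => i /=; rewrite scalerDl. Qed.

HB.instance Definition _ := GRing.Zmodule_isLmodule.Build k dsum
  dsum_scaleA dsum_scale1 dsum_scaleDr dsum_scaleDl.

Fact dinj_subproof i (x : M i) : finsupp_fun (dfwith (fun j => 0 : M j) x).
Proof.
apply/asboolP; exists [:: i] => j; rewrite inE => ji.
by rewrite dfwith_out // eq_sym.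
Qed.
Definition dinj i (x : M i) : dsum := DSum (dinj_subproof x).

End DirectSum.

Section Tensor.
Variables (k : comPzRingType) (U V : lmodType k).

Definition free_tens := dsum (fun _ : U * V => k^o : lmodType k).
HB.instance Definition _ := GRing.Lmodule.on free_tens.

Definition free_pair (u : U) (v : V) : free_tens :=
  @dinj k _ (fun _ : U * V => k^o : lmodType k) (u, v) (1 : k).

Inductive bilin_rel : free_tens -> Prop :=
| BilinDl u u' v :
    bilin_rel (free_pair (u + u') v - free_pair u v - free_pair u' v)
| BilinDr u v v' :
    bilin_rel (free_pair u (v + v') - free_pair u v - free_pair u v')
| BilinZl a u v : bilin_rel (free_pair (a *: u) v - a *: free_pair u v)
| BilinZr a u v : bilin_rel (free_pair u (a *: v) - a *: free_pair u v)
| Bilin0 : bilin_rel 0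
| BilinLin a x y : bilin_rel x -> bilin_rel y -> bilin_rel (a *: x + y).

Definition tens_null : {pred free_tens} := fun x => `[< bilin_rel x >].

Fact tens_null_zmod_closed : zmod_closed tens_null.
Proof.
split=> [|x y /asboolP xP /asboolP yP]; apply/asboolP; first exact: Bilin0.
by rewrite addrC -scaleN1r; exact: BilinLin.
Qed.
HB.instance Definition _ :=
  GRing.isZmodClosed.Build free_tens tens_null tens_null_zmod_closed.

Definition tens := Quotient.quot tens_null.
HB.instance Definition _ := GRing.Zmodule.on tens.
HB.instance Definition _ := EqQuotient.on tens.
HB.instance Definition _ := ZmodQuotient.on tens.

Definition tens_scale (a : k) (t : tens) : tens := \pi_tens (a *: repr t).

Lemma tens_eqP (x y : free_tens) :
  \pi_tens x = \pi_tens y <-> bilin_rel (x - y).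
Proof.
split=> [/eqP|/asboolP] xy; last by apply/eqP; rewrite -[_ == _]Quotient.idealrBE.
by move: xy; rewrite -[_ == _]Quotient.idealrBE => /asboolP.
Qed.

Fact tens_scale_pi a x : tens_scale a (\pi_tens x) = \pi_tens (a *: x).
Proof.
apply/tens_eqP; rewrite -scalerBr -[_ *: _]addr0.
by apply: BilinLin; [apply/tens_eqP; exact: reprK | exact: Bilin0].
Qed.

Fact tens_scaleA a b t : tens_scale a (tens_scale b t) = tens_scale (a * b) t.
Proof. by rewrite [tens_scale b t]/tens_scale tens_scale_pi scalerA. Qed.
Fact tens_scale1 : left_id 1 tens_scale.
Proof. by move=> t; rewrite /tens_scale scale1r reprK. Qed.
Fact tens_scaleDr : right_distributive tens_scale +%R.
Proof.
move=> a t t'.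
have -> : t + t' = \pi_tens (repr t + repr t') by rewrite raddfD -[t in LHS]reprK -[t' in LHS]reprK.
by rewrite tens_scale_pi scalerDr raddfD.
Qed.
Fact tens_scaleDl t : {morph tens_scale^~ t : a b / a + b}.
Proof. by move=> a b; rewrite /tens_scale scalerDl raddfD. Qed.

HB.instance Definition _ := GRing.Zmodule_isLmodule.Build k tens
  tens_scaleA tens_scale1 tens_scaleDr tens_scaleDl.

Definition tpure (u : U) (v : V) : tens := \pi_tens (free_pair u v).

Lemma tpureZl a u v : tpure (a *: u) v = a *: tpure u v.
Proof.
rewrite /tpure [RHS]tens_scale_pi.
by apply/tens_eqP; exact: BilinZl.
Qed.
Lemma tpureZr a u v : tpure u (a *: v) = a *: tpure u v.
Proof.
rewrite /tpure [RHS]tens_scale_pi.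
by apply/tens_eqP; exact: BilinZr.
Qed.

Lemma tpure0l v : tpure 0 v = 0.
Proof. by rewrite -(scale0r (0 : U)) tpureZl scale0r. Qed.
Lemma tpure0r u : tpure u 0 = 0.
Proof. by rewrite -(scale0r (0 : V)) tpureZr scale0r. Qed.

End Tensor.

(* Composition is totalized: [cmp g f] is g o f, constrained only when
   [tgt f = src g].  The [choiceType]s carry no restriction classically. *)
Record small_category := SmallCategory {
  obj : choiceType;
  mor : choiceType;
  src : mor -> obj;
  tgt : mor -> obj;
  idm : obj -> mor;
  cmp : mor -> mor -> mor;
  src_idm : forall X, src (idm X) = X;
  tgt_idm : forall X, tgt (idm X) = X;
  src_cmp : forall f g, tgt f = src g -> src (cmp g f) = src f;
  tgt_cmp : forall f g, tgt f = src g -> tgt (cmp g f) = tgt g;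
  cmp_idr : forall f, cmp f (idm (src f)) = f;
  cmp_idl : forall f, cmp (idm (tgt f)) f = f;
  cmpA : forall f g h, tgt f = src g -> tgt g = src h ->
    cmp h (cmp g f) = cmp (cmp h g) f
}.

Notation "g \oc f" := (cmp g f) (at level 40, left associativity).

Section Graded.
Variables (k : comPzRingType) (C : small_category).

Definition composable (f g : mor C) : bool := tgt f == src g.

(* [alpha f1 f2 f3] is meaningful only on composable triples (f3 o f2 o f1);
   its other values are never used. *)
Record grading := Grading {
  alpha :> mor C -> mor C -> mor C -> kunit k;
  alpha_cocycle : forall f1 f2 f3 f4,
    composable f1 f2 -> composable f2 f3 -> composable f3 f4 ->
    uval (alpha f1 f2 f3) * uinv (alpha f1 f2 (f4 \oc f3))
      * uval (alpha f1 (f3 \oc f2) f4) * uinv (alpha (f2 \oc f1) f3 f4)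
      * uval (alpha f2 f3 f4) = 1
}.

Definition unitorL (a : grading) (g : mor C) : k :=
  uinv (a (idm (src g)) (idm (src g)) g).
Definition unitorR (a : grading) (g : mor C) : k :=
  uval (a g (idm (tgt g)) (idm (tgt g))).

(* A graded module is given by its family of components; [tot M] is the
   k-module that is their direct sum. *)
Definition gmod := mor C -> lmodType k.

Definition tot (M : gmod) := dsum M.
HB.instance Definition _ M := GRing.Lmodule.on (tot M).

Definition homog (M : gmod) (g : mor C) (x : tot M) : Prop :=
  exists y : M g, x = dinj y.

Definition graded_map (M N : gmod) (F : tot M -> tot N) : Prop :=
  forall g x, homog g x -> homog g (F x).

Definition decomp (g : mor C) : choiceType :=
  {p : mor C * mor C | composable p.1 p.2 && (p.2 \oc p.1 == g)}.

Definition gtens (M N : gmod) : gmod := fun g =>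
  dsum (fun p : decomp g => tens (M (val p).1) (N (val p).2) : lmodType k).

Section PureTensor.
Variables (M N : gmod) (x : tot M) (y : tot N).

Definition ptens_comp (g : mor C) (p : decomp g) :
    tens (M (val p).1) (N (val p).2) :=
  tpure (x (val p).1) (y (val p).2).

Fact ptens_comp_subproof g : finsupp_fun (@ptens_comp g).
Proof.
apply/asboolP; have [s sP] := dsum_finsupp x; have [t tP] := dsum_finsupp y.
exists (pmap insub [seq (f, h) | f <- s, h <- t]) => p.
rewrite mem_pmap_sub /ptens_comp => pN.
have [ps|/sP ->] := boolP ((val p).1 \in s); last exact: tpure0l.
have [pt|/tP ->] := boolP ((val p).2 \in t); last exact: tpure0r.
by case/negP: pN; apply/allpairsP; exists (val p); split=> //; case: (val p).
Qed.

Fact ptens_subproof :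
  finsupp_fun (fun g => DSum (ptens_comp_subproof g) : gtens M N g).
Proof.
apply/asboolP; have [s sP] := dsum_finsupp x; have [t tP] := dsum_finsupp y.
exists [seq h \oc f | f <- s, h <- t] => g gN; apply: dsumP => p /=.
rewrite /ptens_comp.
have [ps|/sP ->] := boolP ((val p).1 \in s); last exact: tpure0l.
have [pt|/tP ->] := boolP ((val p).2 \in t); last exact: tpure0r.
case/negP: gN; apply/allpairsP; exists (val p); split=> //.
by case/andP: (valP p) => _ /eqP.
Qed.

(* x (x) y, whose component of degree g is the family of all
   x_f (x) y_h with g = h o f; the non-composable products are dropped. *)
Definition ptens : tot (gtens M N) := DSum ptens_subproof.

End PureTensor.

Section Algebras.
Variable a : grading.

Record galgebra := GAlgebra {
  gcar :> gmod;
  gmu : {linear tot (gtens gcar gcar) -> tot gcar};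
  gone : obj C -> tot gcar;
  gmu_graded : graded_map gmu;
  gone_homog : forall X, homog (idm X) (gone X);
  gmuA : forall f g h x y z, composable f g -> composable g h ->
    homog f x -> homog g y -> homog h z ->
    gmu (ptens (gmu (ptens x y)) z) = uval (a f g h) *: gmu (ptens x (gmu (ptens y z)));
  gmu1l : forall g x, homog g x ->
    gmu (ptens (gone (src g)) x) = unitorL a g *: x;
  gmu1r : forall g x, homog g x ->
    gmu (ptens x (gone (tgt g))) = unitorR a g *: x
}.

Definition gmul (A : galgebra) (x y : tot A) : tot A := gmu A (ptens x y).

Record is_bimodule (A B : galgebra) (M : gmod)
    (rhoL : {linear tot (gtens A M) -> tot M})
    (rhoR : {linear tot (gtens M B) -> tot M}) : Prop := IsBimodule {
  rhoL_graded : graded_map rhoL;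
  rhoR_graded : graded_map rhoR;
  rhoL_mul : forall f g h (x y : tot A) (m : tot M),
    composable f g -> composable g h ->
    homog f x -> homog g y -> homog h m ->
    rhoL (ptens (gmul x y) m) = uval (a f g h) *: rhoL (ptens x (rhoL (ptens y m)));
  rhoR_mul : forall f g h (m : tot M) (x y : tot B),
    composable f g -> composable g h ->
    homog f m -> homog g x -> homog h y ->
    rhoR (ptens (rhoR (ptens m x)) y) = uval (a f g h) *: rhoR (ptens m (gmul x y));
  rhoLR : forall f g h (x : tot A) (m : tot M) (y : tot B),
    composable f g -> composable g h ->
    homog f x -> homog g m -> homog h y ->
    rhoR (ptens (rhoL (ptens x m)) y) = uval (a f g h) *: rhoL (ptens x (rhoR (ptens m y)));
  rhoL1 : forall g (m : tot M), homog g m ->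
    rhoL (ptens (gone A (src g)) m) = unitorL a g *: m;
  rhoR1 : forall g (m : tot M), homog g m ->
    rhoR (ptens m (gone B (tgt g))) = unitorR a g *: m
}.

Definition bigmod := int -> gmod.

Definition hsum (M : bigmod) : gmod := fun g =>
  dsum (fun n => M n g).

Definition bihomog (M : bigmod) (n : int) (g : mor C) (x : tot (hsum M)) : Prop :=
  exists y : M n g, x = dinj (dinj y : hsum M g).

Record is_dg_bimodule (A B : galgebra) (M : bigmod)
    (rhoL : {linear tot (gtens A (hsum M)) -> tot (hsum M)})
    (rhoR : {linear tot (gtens (hsum M) B) -> tot (hsum M)})
    (d : {linear tot (hsum M) -> tot (hsum M)}) : Prop := IsDGBimodule {
  dg_bimodule : is_bimodule rhoL rhoR;
  rhoL_hdeg : forall n f g (x : tot A) (m : tot (hsum M)), composable f g ->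
    homog f x -> bihomog n g m -> bihomog n (g \oc f) (rhoL (ptens x m));
  rhoR_hdeg : forall n f g (m : tot (hsum M)) (x : tot B), composable f g ->
    bihomog n f m -> homog g x -> bihomog n (g \oc f) (rhoR (ptens m x));
  d_bideg : forall n g m, bihomog n g m -> bihomog (n - 1) g (d m);
  d_rhoL : forall (x : tot A) (m : tot (hsum M)),
    d (rhoL (ptens x m)) = rhoL (ptens x (d m));
  d_rhoR : forall (m : tot (hsum M)) (x : tot B),
    d (rhoR (ptens m x)) = rhoR (ptens (d m) x);
  d_d : forall m, d (d m) = 0
}.

End Algebras.

Section Bar.
Variables (a : grading) (A : galgebra a).

(* [tpow n] is the (n+1)-fold tensor power of A, parenthesized to the left. *)
Fixpoint tpow (n : nat) : gmod :=
  if n is n'.+1 then gtens (tpow n') A else A.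

Fixpoint tpow_pure (n : nat) (x : nat -> tot A) : tot (tpow n) :=
  match n return tot (tpow n) with
  | 0%N => x 0%N
  | n'.+1 => ptens (tpow_pure n' x) (x n'.+1)
  end.

Definition bar : bigmod := fun n g =>
  match n with
  | Posz n => tpow n.+1 g
  | Negz _ => 'rV[k]_0 : lmodType k
  end.

Section BarInclusion.
Variables (n : nat) (t : tot (tpow n.+1)).

Fact bar_in_subproof :
  finsupp_fun (fun g => @dinj _ _ (fun i => bar i g) (Posz n) (t g) : hsum bar g).
Proof.
apply/asboolP; have [s sP] := dsum_finsupp t; exists s => g /sP ->.
by apply: dsumP => i /=; case: dfwithP.
Qed.

Definition bar_in : tot (hsum bar) := DSum bar_in_subproof.

End BarInclusion.

(* x_0 (x) ... (x) x_(n+1), in homological degree n; only the values of x up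
   to n+1 matter. *)
Definition bar_pure (n : nat) (x : nat -> tot A) : tot (hsum bar) :=
  bar_in (tpow_pure n.+1 x).

Fixpoint degs (g : nat -> mor C) (i : nat) : mor C :=
  if i is i'.+1 then g i \oc degs g i' else g 0%N.

Definition homog_chain (n : nat) (g : nat -> mor C) (x : nat -> tot A) : Prop :=
  (forall i, (i <= n)%N -> homog (g i) (x i)) /\
  (forall i, (i < n)%N -> composable (g i) (g i.+1)).

Definition set_at (i : nat) (y : tot A) (x : nat -> tot A) : nat -> tot A :=
  fun j => if j == i then y else x j.

Definition merge_at (i : nat) (x : nat -> tot A) : nat -> tot A :=
  fun j => if (j < i)%N then x j
           else if j == i then gmul (x i) (x i.+1) else x j.+1.

Definition bar_face_coef (g : nat -> mor C) (i : nat) : k :=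
  if i is i'.+1 then uval (a (degs g i') (g i) (g i.+1)) else 1.

(* Pure tensors of homogeneous elements along composable chains span the bar
   module, so this and the two specifications below each determine at most one
   linear map. *)
Definition bar_diff_spec (d : tot (hsum bar) -> tot (hsum bar)) : Prop :=
  (forall g x, homog_chain 1 g x -> d (bar_pure 0 x) = 0) /\
  (forall n g x, homog_chain n.+2 g x ->
    d (bar_pure n.+1 x) =
      \sum_(0 <= i < n.+2)
        ((-1) ^+ i * bar_face_coef g i) *: bar_pure n (merge_at i x)).

Definition bar_Phi (n : nat) (h : mor C) (g : nat -> mor C) : k :=
  \prod_(1 <= i < n.+2) uinv (a h (degs g i.-1) (g i)).

Definition bar_Psi (n : nat) (g : nat -> mor C) (h : mor C) : k :=
  uval (a (degs g n) (g n.+1) h).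

Definition bar_left_spec
    (rhoL : tot (gtens A (hsum bar)) -> tot (hsum bar)) : Prop :=
  forall n h g y x, homog_chain n.+1 g x -> homog h y -> composable h (g 0%N) ->
    rhoL (ptens y (bar_pure n x)) =
      bar_Phi n h g *: bar_pure n (set_at 0 (gmul y (x 0%N)) x).

Definition bar_right_spec
    (rhoR : tot (gtens (hsum bar) A) -> tot (hsum bar)) : Prop :=
  forall n g h x y, homog_chain n.+1 g x -> homog h y -> composable (g n.+1) h ->
    rhoR (ptens (bar_pure n x) y) =
      bar_Psi n g h *: bar_pure n (set_at n.+1 (gmul (x n.+1) y) x).

End Bar.
End Graded.

(* Main.v *)
Require Import Defs.
From HB Require Import structures.
From mathcomp Require Import all_boot all_order all_algebra.
From mathcomp Require Import boolp ring.

(* Write T_n for the (n+1)-fold tensor power of A, so that T_(n+1) = T_n (x) A.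
   If M is a left and N a right module, then M (x) N is a bimodule, with actions
   twisted by the associator: x.(u (x) y) = alpha^-1 (x.u) (x) y and
   (u (x) y).z = alpha u (x) (y.z); all axioms reduce to the cocycle identity.
   Iterating the left action produces the product Phi, while the right action
   R_n of A on T_n has the single factor Psi.  The last face of the bar
   differential is R_n itself, hence d_(n+1) = d_n (x) id + (-1)^(n+1) R_(n+1)
   with d_0 = R_0 = mu.  By induction d is compatible with both actions, and
   then d d = 0, because right linearity makes the two terms R_n (d_n (x) id)
   in d_n d_(n+1) cancel. *)

Set Implicit Arguments.
Unset Strict Implicit.
Unset Printing Implicit Defensive.

Import GRing.Theory.
Local Open Scope ring_scope.
Local Open Scope quotient_scope.

Definition mklinear (k : comPzRingType) (U V : lmodType k) (F : U -> V)
    (Flin : linear F) : {linear U -> V} :=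
  HB.pack F (GRing.isLinear.Build k U V *:%R F Flin).

(** * Direct sums and tensor products *)

Section DirectSumLift.
Variables (k : comPzRingType) (I : choiceType) (M : I -> lmodType k).

Lemma dinj_id i (x : M i) : dinj x i = x.
Proof. exact: dfwith_in. Qed.

Lemma dinj_neq i j (x : M i) : i != j -> dinj x j = 0.
Proof. by move=> ij; rewrite /= dfwith_out. Qed.

Lemma dinj_is_linear i : linear (@dinj k I M i).
Proof.
move=> c x y; apply: dsumP => j /=.
have [<-|ij] := eqVneq i j; first by rewrite !dfwith_in.
by rewrite !dfwith_out // scaler0 addr0.
Qed.
HB.instance Definition _ i :=
  GRing.isLinear.Build k (M i) (dsum M) *:%R (@dinj k I M i)
    (@dinj_is_linear i).

Definition dcomp i (x : dsum M) : M i := x i.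

Lemma dcomp_is_linear i : linear (@dcomp i).
Proof. by []. Qed.
HB.instance Definition _ i :=
  GRing.isLinear.Build k (dsum M) (M i) *:%R (@dcomp i) (@dcomp_is_linear i).

Lemma dsum_sumE (x : dsum M) s : uniq s -> (forall i, i \notin s -> x i = 0) ->
  x = \sum_(i <- s) dinj (x i).
Proof.
move=> us xs; apply: dsumP => i.
rewrite -[RHS]/(dcomp i _) raddf_sum /dcomp /=.
have [si|nsi] := boolP (i \in s).
  rewrite (bigD1_seq i) //= dfwith_in big1 ?addr0 // => j ji.
  by rewrite dfwith_out.
rewrite xs // big_seq big1 // => j js; rewrite dfwith_out //.
by apply: contraNneq nsi => <-.
Qed.

Lemma dsum_ind (P : dsum M -> Prop) :
  P 0 -> (forall x y, P x -> P y -> P (x + y)) ->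
  (forall i (x : M i), P (dinj x)) -> forall x, P x.
Proof.
move=> P0 PD Pi x; have [s xs] := dsum_finsupp x.
rewrite (@dsum_sumE x (undup s)) ?undup_uniq // => [|i]; last first.
  by rewrite mem_undup => /xs.
by apply: (big_ind P) => // i _; exact: Pi.
Qed.

Variables (W : lmodType k) (phi : forall i, {linear M i -> W}).

(** Universal property of the direct sum. A finite support is only known to exist, so the lift sums
    over a chosen one, and independence of that choice has to be shown before linearity. *)
Lemma dsum_lift_ex : exists F : {linear dsum M -> W},
  forall i (x : M i), F (dinj x) = phi i x.
Proof.
have supp (x : dsum M) :
    exists s, uniq s /\ forall i, i \notin s -> x i = 0.
  have [s xs] := dsum_finsupp x; exists (undup s).
  by split=> [|i]; rewrite ?undup_uniq // mem_undup => /xs.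
pose F x := \sum_(i <- sval (cid (supp x))) phi i (x i).
have FE (x : dsum M) s : uniq s -> (forall i, i \notin s -> x i = 0) ->
    F x = \sum_(i <- s) phi i (x i).
  rewrite /F; case: cid => t [/= ut xt] us xs.
  (* Terms outside the intersection of the two lists vanish, and the two filtered lists are
     permutations of each other. *)
  rewrite (bigID (mem s)) [RHS](bigID (mem t)) /=.
  rewrite [X in _ + X]big1 => [|i /xs ->]; last by rewrite linear0.
  rewrite [X in _ = _ + X]big1 => [|i /xt ->]; last by rewrite linear0.
  rewrite !addr0 -[LHS]big_filter -[RHS]big_filter.
  apply: perm_big; apply: uniq_perm.
  - exact: filter_uniq.
  - exact: filter_uniq.
  - by move=> i; rewrite !mem_filter andbC.
have Flin : linear F.
  move=> c x y; have [s [us xs]] := supp x; have [t [ut yt]] := supp y.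
  (* One list covering both supports also covers that of [c *: x + y], so the three sums can be
     compared term by term. *)
  have ust : uniq (undup (s ++ t)) by rewrite undup_uniq.
  have xst i : i \notin undup (s ++ t) -> x i = 0.
    by rewrite mem_undup mem_cat negb_or => /andP[/xs].
  have yst i : i \notin undup (s ++ t) -> y i = 0.
    by rewrite mem_undup mem_cat negb_or => /andP[_ /yt].
  rewrite !(FE _ (undup (s ++ t))) // => [|i st]; last first.
    by rewrite /= xst // yst // scaler0 addr0.
  rewrite scaler_sumr -big_split /=; apply: eq_bigr => i _.
  by rewrite linearP.
exists (mklinear Flin) => i x; rewrite /= (FE _ [:: i]) // => [|j].
  by rewrite big_seq1 dinj_id.
by rewrite inE => ji; rewrite dinj_neq // eq_sym.
Qed.

End DirectSumLift.

(** * Bilinear maps and the universal property of the tensor product *)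

Definition bilin (k : comPzRingType) (U V W : lmodType k) (b : U -> V -> W) :=
  (forall v, linear (b^~ v)) /\ (forall u, linear (b u)).

Section BilinTheory.
Variables (k : comPzRingType) (U V W : lmodType k) (b : U -> V -> W).
Hypothesis bb : bilin b.

Lemma bilinDl u u' v : b (u + u') v = b u v + b u' v.
Proof. by have := bb.1 v 1 u u'; rewrite !scale1r. Qed.

Lemma bilinDr u v v' : b u (v + v') = b u v + b u v'.
Proof. by have := bb.2 u 1 v v'; rewrite !scale1r. Qed.

Lemma bilin0l v : b 0 v = 0.
Proof. by apply: (@addrI _ (b 0 v)); rewrite -bilinDl !addr0. Qed.

Lemma bilin0r u : b u 0 = 0.
Proof. by apply: (@addrI _ (b u 0)); rewrite -bilinDr !addr0. Qed.

Lemma bilinZl c u v : b (c *: u) v = c *: b u v.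
Proof. by have := bb.1 v c u 0; rewrite !addr0 bilin0l addr0. Qed.

Lemma bilinZr c u v : b u (c *: v) = c *: b u v.
Proof. by have := bb.2 u c v 0; rewrite !addr0 bilin0r addr0. Qed.

End BilinTheory.

Section TensorLift.
Variables (k : comPzRingType) (U V : lmodType k).

Lemma pi_tensZ c (x : free_tens U V) :
  \pi_(tens U V) (c *: x) = c *: \pi_(tens U V) x.
Proof. by rewrite [RHS]tens_scale_pi. Qed.

Lemma tens_ind (P : tens U V -> Prop) :
  P 0 -> (forall x y, P x -> P y -> P (x + y)) ->
  (forall u v, P (tpure u v)) -> forall x, P x.
Proof.
move=> P0 PD Pp t; rewrite -[t]reprK.
elim/dsum_ind: (repr t) => [|x y Px Py|[u v] c].
- by rewrite raddf0.
- by rewrite raddfD; exact: PD.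
(* A coefficient is absorbed into the left factor, so plain sums of pure tensors exhaust the tensor
   product. *)
- rewrite (_ : dinj _ = (c : k) *: free_pair u v); last first.
    rewrite -linearZ; congr (dinj _); exact: esym (mulr1 c).
  by rewrite pi_tensZ -/(tpure u v) -tpureZl.
Qed.

Lemma tpure_bilin : bilin (@tpure k U V).
Proof.
have DE (x y z : free_tens U V) : bilin_rel (x - y - z) ->
    \pi_(tens U V) x = \pi_(tens U V) y + \pi_(tens U V) z.
  by move=> h; rewrite -raddfD; apply/tens_eqP; rewrite opprD addrA.
split=> [v|u] c x y.
  by rewrite -tpureZl; apply: DE; exact: BilinDl.
by rewrite -tpureZr; apply: DE; exact: BilinDr.
Qed.

Variables (W : lmodType k) (b : U -> V -> W).
Hypothesis bb : bilin b.

Lemma tens_lift_ex : exists F : {linear tens U V -> W},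
  forall u v, F (tpure u v) = b u v.
Proof.
have philin p : linear (fun c : k^o => c *: b p.1 p.2).
  by move=> c x y; rewrite scalerDl scalerA.
have [G GE] := dsum_lift_ex (fun p => mklinear (philin p)).
have Gp u v : G (free_pair u v) = b u v by rewrite GE /= scale1r.
(* The extension to the free module kills the defining relations, by induction on their
   derivation. *)
have Gr x : bilin_rel x -> G x = 0.
  elim=> [u u' v|u v v'|c u v|c u v||c y z _ y0 _ z0].
  - by rewrite !raddfB /= !Gp (bilinDl bb) -addrA -opprD subrr.
  - by rewrite !raddfB /= !Gp (bilinDr bb) -addrA -opprD subrr.
  - by rewrite raddfB /= linearZ /= !Gp (bilinZl bb) subrr.
  - by rewrite raddfB /= linearZ /= !Gp (bilinZr bb) subrr.
  - exact: raddf0.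
  - by rewrite linearP y0 z0 scaler0 addr0.
(* Evaluation on a chosen representative; two representatives differ by a relation, so the choice
   does not matter. *)
pose F (t : tens U V) := G (repr t).
have Fpi x : F (\pi_(tens U V) x) = G x.
  apply/eqP; rewrite -subr_eq0 -raddfB; apply/eqP/Gr/tens_eqP.
  exact: reprK.
have Flin : linear F.
  move=> c x y; rewrite -[x in LHS]reprK -[y in LHS]reprK.
  by rewrite -pi_tensZ -raddfD Fpi linearP.
exists (mklinear Flin) => u v.
by rewrite /= Fpi Gp.
Qed.

End TensorLift.

(** * Graded modules *)

Section GradedModules.
Variables (k : comPzRingType) (C : small_category).
Implicit Types (f g h : mor C) (M N : gmod k C).

Lemma composable_cmpl f g h :
  composable f g -> composable g h -> composable (g \oc f) h.
Proof. by move=> /eqP fg /eqP gh; rewrite /composable tgt_cmp // gh. Qed.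

Lemma composable_cmpr f g h :
  composable f g -> composable g h -> composable f (h \oc g).
Proof. by move=> /eqP fg /eqP gh; rewrite /composable src_cmp // fg. Qed.

Lemma composable_cmpEl f g h :
  composable f g -> composable (g \oc f) h = composable g h.
Proof. by move=> /eqP fg; rewrite /composable tgt_cmp. Qed.

Lemma composable_cmpEr f g h :
  composable g h -> composable f (h \oc g) = composable f g.
Proof. by move=> /eqP gh; rewrite /composable src_cmp. Qed.

Lemma composable_cmpA f g h : composable f g -> composable g h ->
  h \oc (g \oc f) = (h \oc g) \oc f.
Proof. by move=> /eqP fg /eqP gh; exact: cmpA. Qed.

Section Homog.
Variable M : gmod k C.
Implicit Types x y : tot M.

Lemma homog0 g : homog g (0 : tot M).
Proof. by exists 0; rewrite raddf0. Qed.

Lemma homogD g x y : homog g x -> homog g y -> homog g (x + y).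
Proof. by move=> [u ->] [v ->]; exists (u + v); rewrite raddfD. Qed.

Lemma homogZ g c x : homog g x -> homog g (c *: x).
Proof. by move=> [u ->]; exists (c *: u); rewrite linearZ. Qed.

Lemma tot_ind (P : tot M -> Prop) :
  P 0 -> (forall x y, P x -> P y -> P (x + y)) ->
  (forall g x, homog g x -> P x) -> forall x, P x.
Proof.
by move=> P0 PD Ph; apply: dsum_ind => // g x; apply: (Ph g); exists x.
Qed.

End Homog.

Section Tensor.
Variables M N : gmod k C.

Lemma ptens_bilin : bilin (@ptens k C M N).
Proof.
by split=> [y|x] c u v; apply: dsumP => g; apply: dsumP => p;
  [exact: (tpure_bilin _ _).1|exact: (tpure_bilin _ _).2].
Qed.

(** Matches the generators of the nested direct sum [gtens M N] with products of homogeneous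
    elements, so that induction and lifting can be phrased through [ptens]. *)
Lemma ptens_dinj g (p : decomp g) (u : M (val p).1) (v : N (val p).2) :
  dinj (dinj (tpure u v) : gtens M N g) = ptens (dinj u) (dinj v).
Proof.
apply: dsumP => g'; apply: dsumP => q.
have [gg'|gg'] := eqVneq g g'; last first.
  rewrite dinj_neq //= /ptens_comp.
  have [E1|pq] := eqVneq (val p).1 (val q).1; last first.
    by rewrite [X in tpure X _](dinj_neq _ pq) tpure0l.
  have [E2|pq] := eqVneq (val p).2 (val q).2; last first.
    by rewrite [X in tpure _ X](dinj_neq _ pq) tpure0r.
  case/eqP: gg'; case/andP: (valP p) => _ /eqP <-.
  by case/andP: (valP q) => _ /eqP <-; rewrite E1 E2.
subst g'; rewrite dinj_id.
have [pq|pq] := eqVneq p q.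
  by subst q; rewrite dinj_id /= /ptens_comp /= !dfwith_in.
rewrite dinj_neq //= /ptens_comp.
have [E1|np] := eqVneq (val p).1 (val q).1; last first.
  by rewrite [X in tpure X _](dinj_neq _ np) tpure0l.
have [E2|np] := eqVneq (val p).2 (val q).2; last first.
  by rewrite [X in tpure _ X](dinj_neq _ np) tpure0r.
case/eqP: pq; apply: val_inj.
by rewrite [val p]surjective_pairing E1 E2 -surjective_pairing.
Qed.

(** No decomposition in [decomp] has the degrees [f] and [h]. Identities required for arbitrary
    elements can therefore be checked on composable degrees. *)
Lemma ptens_noncomposable f h (x : tot M) (y : tot N) :
  homog f x -> homog h y -> ~~ composable f h -> ptens x y = 0.
Proof.
move=> [u ->] [v ->] nfh; apply: dsumP => g; apply: dsumP => p /=.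
rewrite /ptens_comp.
have [E1|np] := eqVneq f (val p).1; last first.
  by rewrite [X in tpure X _](dinj_neq _ np) tpure0l.
have [E2|np] := eqVneq h (val p).2; last first.
  by rewrite [X in tpure _ X](dinj_neq _ np) tpure0r.
by case/negP: nfh; rewrite E1 E2; case/andP: (valP p).
Qed.

Lemma homog_ptens f h (x : tot M) (y : tot N) : composable f h ->
  homog f x -> homog h y -> homog (h \oc f) (ptens x y).
Proof.
move=> fh [u ->] [v ->].
have pP : composable (f, h).1 (f, h).2 && ((f, h).2 \oc (f, h).1 == h \oc f).
  by rewrite fh eqxx.
pose p : decomp (h \oc f) := exist _ (f, h) pP.
exists (dinj (tpure u v : tens (M (val p).1) (N (val p).2))).
by rewrite ptens_dinj.
Qed.

Lemma homog_gtens_ind g (P : tot (gtens M N) -> Prop) :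
  P 0 -> (forall x y, P x -> P y -> P (x + y)) ->
  (forall f h x y, composable f h -> h \oc f = g ->
    homog f x -> homog h y -> P (ptens x y)) ->
  forall t, homog g t -> P t.
Proof.
move=> P0 PD Pp t [t' ->]; elim/dsum_ind: t' => [|x y Px Py|p t'].
- by rewrite raddf0.
- by rewrite raddfD; exact: PD.
elim/tens_ind: t' => [|x y Px Py|u v].
- by rewrite !raddf0.
- by rewrite !raddfD; exact: PD.
rewrite ptens_dinj; case/andP: (valP p) => fh /eqP E.
by apply: Pp fh E _ _; eexists.
Qed.

Lemma gtens_ind (P : tot (gtens M N) -> Prop) :
  P 0 -> (forall x y, P x -> P y -> P (x + y)) ->
  (forall f h x y, composable f h -> homog f x -> homog h y ->
    P (ptens x y)) ->
  forall t, P t.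
Proof.
move=> P0 PD Pp; apply: tot_ind => // g t; apply: homog_gtens_ind => //.
by move=> f h x y fh _; exact: Pp.
Qed.

(** Universal property of the graded tensor product. The bilinear map is indexed by a pair of
    degrees, which lets factors such as [alpha f g h] enter the maps built from it. *)
Lemma gtens_lift_ex (W : lmodType k)
    (b : mor C -> mor C -> tot M -> tot N -> W) :
  (forall f h, bilin (b f h)) ->
  exists F : {linear tot (gtens M N) -> W}, forall f h x y,
    composable f h -> homog f x -> homog h y -> F (ptens x y) = b f h x y.
Proof.
move=> bb.
have bp g (p : decomp g) : bilin (fun (u : M (val p).1) (v : N (val p).2) =>
    b (val p).1 (val p).2 (dinj u) (dinj v)).
  by split=> [v|u] c x y; rewrite linearP /= ?(bb _ _).1 ?(bb _ _).2.
(* The lift is made over each decomposition, then over all decompositions of a fixed degree, then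
   over all degrees. *)
pose psi g p := sval (cid (tens_lift_ex (@bp g p))).
pose phi g := sval (cid (dsum_lift_ex (psi g))).
have [F FE] := dsum_lift_ex phi.
exists F => f h _ _ fh [u ->] [v ->].
have pP : composable (f, h).1 (f, h).2 && ((f, h).2 \oc (f, h).1 == h \oc f).
  by rewrite fh eqxx.
pose p : decomp (h \oc f) := exist _ (f, h) pP.
rewrite -(@ptens_dinj _ p) FE /phi; case: cid => /= G ->.
by rewrite /psi; case: cid => /= H ->.
Qed.

End Tensor.

End GradedModules.

(** * Tensor products of bimodules *)

Section TensorBimodule.
Variables (k : comPzRingType) (C : small_category) (a : grading k C).
Implicit Types (f g h : mor C) (M N P : gmod k C).

(** * Forms of the cocycle identity *)

Lemma kunitI (u : kunit k) (x y : k) : uval u * x = uval u * y -> x = y.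
Proof.
by move=> /(congr1 ( *%R (uinv u))); rewrite !mulrA mulrC (mulrC (uinv u))
  uvalK mulr1 mul1r.
Qed.

(** The pentagon identity: the cocycle condition multiplied by the two factors that it inverts. *)
Lemma cocycleE f1 f2 f3 f4 :
  composable f1 f2 -> composable f2 f3 -> composable f3 f4 ->
  uval (a f1 f2 f3) * uval (a f1 (f3 \oc f2) f4) * uval (a f2 f3 f4) =
  uval (a f1 f2 (f4 \oc f3)) * uval (a (f2 \oc f1) f3 f4).
Proof.
move=> c12 c23 c34; have := alpha_cocycle a c12 c23 c34.
have := uvalK (a f1 f2 (f4 \oc f3)); have := uvalK (a (f2 \oc f1) f3 f4).
set u1 := uval (a f1 f2 f3); set u2 := uval (a f1 _ f4).
set u3 := uval (a f2 f3 f4).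
move: (uval _) (uinv _) (uval _) (uinv _) => v v' w w' vK wK E.
rewrite -[RHS]mulr1 -E; ring: vK wK.
Qed.

(** The form behind associativity of the left action on a tensor product. *)
Lemma cocycleV_left f1 f2 f3 f4 :
  composable f1 f2 -> composable f2 f3 -> composable f3 f4 ->
  uval (a f1 f2 f3) * uinv (a (f2 \oc f1) f3 f4) =
  uval (a f1 f2 (f4 \oc f3)) * uinv (a f2 f3 f4)
    * uinv (a f1 (f3 \oc f2) f4).
Proof.
move=> c12 c23 c34; have := cocycleE c12 c23 c34.
have := uvalK (a (f2 \oc f1) f3 f4); have := uvalK (a f2 f3 f4).
have := uvalK (a f1 (f3 \oc f2) f4).
set A := uval (a f1 f2 f3); set B := uval (a f1 f2 _).
move: (uval _) (uinv _) (uval _) (uinv _) (uval _) (uinv _).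
move=> w w' v v' u u' uK vK wK E.
have -> : A * w' = u' * v' * w' * (A * u * v) by ring: uK vK.
rewrite E; ring: wK.
Qed.

(** The form behind the commutation of the left and right actions on a tensor product. *)
Lemma cocycleV_mid f1 f2 f3 f4 :
  composable f1 f2 -> composable f2 f3 -> composable f3 f4 ->
  uval (a (f2 \oc f1) f3 f4) * uinv (a f1 f2 f3) =
  uval (a f1 (f3 \oc f2) f4) * uval (a f2 f3 f4)
    * uinv (a f1 f2 (f4 \oc f3)).
Proof.
move=> c12 c23 c34; have := cocycleE c12 c23 c34.
have := uvalK (a f1 f2 f3); have := uvalK (a f1 f2 (f4 \oc f3)).
set A := uval (a f1 (f3 \oc f2) f4); set B := uval (a f2 f3 f4).
set D := uval (a (f2 \oc f1) f3 f4).
move: (uval _) (uinv _) (uval _) (uinv _) => v v' u u' uK vK E.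
have -> : D * v' = u' * v' * (u * D) by ring: uK.
rewrite -E; ring: vK.
Qed.

(** For [e, e, f, g] with [e] the identity at the source of [f], the pentagon reads alpha(e,e,f)
    alpha(e,f,g)^2 = alpha(e,e,gf) alpha(e,f,g). Cancelling one factor and inverting gives the left
    unit law of a tensor product. *)
Lemma cocycleV_unitl f g : composable f g ->
  uinv (a (idm (src f)) f g) * uinv (a (idm (src f)) (idm (src f)) f) =
  uinv (a (idm (src f)) (idm (src f)) (g \oc f)).
Proof.
move=> fg; set e := idm (src f).
have ee : composable e e by rewrite /composable tgt_idm src_idm.
have ef : composable e f by rewrite /composable tgt_idm.
have e2 : e \oc e = e by have := cmp_idr e; rewrite src_idm.
have := cocycleE ee ef fg; rewrite cmp_idr e2.
have := uvalK (a e e f); have := uvalK (a e f g).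
have := uvalK (a e e (g \oc f)).
move: (uval _) (uinv _) (uval _) (uinv _) (uval _) (uinv _).
move=> w w' v v' u u' uK vK wK E.
have Ew : w * v = u.
  have -> : w * v = w * v * v * v' by ring: vK.
  by rewrite E; ring: vK.
have -> : v' * w' = v' * w' * u * u' by ring: uK.
by rewrite -Ew; ring: vK wK.
Qed.

(** The pentagon at [f, g, e, e], with [e] the identity at the target of [g], after cancelling
    alpha(f,g,e). *)
Lemma cocycle_unitr f g : composable f g ->
  uval (a f g (idm (tgt g))) * uval (a g (idm (tgt g)) (idm (tgt g))) =
  uval (a (g \oc f) (idm (tgt g)) (idm (tgt g))).
Proof.
move=> fg; set e := idm (tgt g).
have ee : composable e e by rewrite /composable tgt_idm src_idm.
have ge : composable g e by rewrite /composable src_idm.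
have e2 : e \oc e = e by have := cmp_idl e; rewrite tgt_idm.
have := cocycleE fg ge ee; rewrite cmp_idl e2.
by rewrite -mulrA => /kunitI.
Qed.

Lemma ptensDl M N (x y : tot M) (z : tot N) :
  ptens (x + y) z = ptens x z + ptens y z.
Proof. exact: (bilinDl (ptens_bilin M N)). Qed.

Lemma ptensDr M N (x : tot M) (y z : tot N) :
  ptens x (y + z) = ptens x y + ptens x z.
Proof. exact: (bilinDr (ptens_bilin M N)). Qed.

Lemma ptensZl M N c (x : tot M) (y : tot N) :
  ptens (c *: x) y = c *: ptens x y.
Proof. exact: (bilinZl (ptens_bilin M N)). Qed.

Lemma ptensZr M N c (x : tot M) (y : tot N) :
  ptens x (c *: y) = c *: ptens x y.
Proof. exact: (bilinZr (ptens_bilin M N)). Qed.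

Lemma ptens0l M N (y : tot N) : ptens (0 : tot M) y = 0.
Proof. exact: (bilin0l (ptens_bilin M N)). Qed.

Lemma ptens0r M N (x : tot M) : ptens x (0 : tot N) = 0.
Proof. exact: (bilin0r (ptens_bilin M N)). Qed.

Definition ptensE := (ptensDl, ptensDr, ptensZl, ptensZr, ptens0l, ptens0r).

Lemma homog_act M N P (F : {linear tot (gtens M N) -> tot P}) f g x y :
  graded_map F -> composable f g -> homog f x -> homog g y ->
  homog (g \oc f) (F (ptens x y)).
Proof. by move=> Fgr fg fx gy; apply: Fgr; exact: homog_ptens. Qed.

(** * One-sided actions on a tensor product, and the bimodule they form *)

Definition tens_left_spec P M N (L : {linear tot (gtens P M) -> tot M})
    (F : {linear tot (gtens P (gtens M N)) -> tot (gtens M N)}) : Prop :=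
  forall f g h x u y, composable f g -> composable g h ->
    homog f x -> homog g u -> homog h y ->
  F (ptens x (ptens u y)) = uinv (a f g h) *: ptens (L (ptens x u)) y.

Definition tens_right_spec M N P (R : {linear tot (gtens N P) -> tot N})
    (F : {linear tot (gtens (gtens M N) P) -> tot (gtens M N)}) : Prop :=
  forall f g h u y z, composable f g -> composable g h ->
    homog f u -> homog g y -> homog h z ->
  F (ptens (ptens u y) z) = uval (a f g h) *: ptens u (R (ptens y z)).

(** The factor depends on three degrees while a lift sees two at a time. Hence two lifts: over
    [u (x) y] for a fixed [x] of prescribed degree [f], then over [x]. *)
Lemma tens_left_ex P M N (L : {linear tot (gtens P M) -> tot M}) :
  exists F : {linear tot (gtens P (gtens M N)) -> tot (gtens M N)},
    tens_left_spec L F.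
Proof.
have bb f x : forall g h, bilin (fun (u : tot M) (y : tot N) =>
    uinv (a f g h) *: ptens (L (ptens x u)) y).
  by move=> g h; split=> [y|u] c v w; rewrite !(ptensE, linearP).
pose G f x := sval (cid (gtens_lift_ex (bb f x))).
have GE f x g h u y : composable g h -> homog g u -> homog h y ->
    G f x (ptens u y) = uinv (a f g h) *: ptens (L (ptens x u)) y.
  by rewrite /G; case: cid => /= H; apply.
(* Linearity in [x] is not part of the first lift; it is checked on generators [u (x) v]. *)
have Gb : forall f h, bilin (fun (x : tot P) (t : tot (gtens M N)) => G f x t).
  move=> f _; split=> [t|x]; last exact: linearP.
  move=> c x y; elim/gtens_ind: t => [|t t' Et Et'|g h u v gh gu hv].
  - by rewrite /= !raddf0 addr0.
  - by rewrite /= !linearD /= Et Et' addrACA.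
  - by rewrite !(GE f _ g h) // !(ptensE, linearP).
have [F FE] := gtens_lift_ex Gb; exists F => f g h x u y fg gh fx gu hy.
rewrite (FE f (h \oc g)) //; [exact: GE|exact: composable_cmpr|].
exact: homog_ptens.
Qed.

Lemma tens_right_ex M N P (R : {linear tot (gtens N P) -> tot N}) :
  exists F : {linear tot (gtens (gtens M N) P) -> tot (gtens M N)},
    tens_right_spec R F.
Proof.
have bb h z : forall f g, bilin (fun (u : tot M) (y : tot N) =>
    uval (a f g h) *: ptens u (R (ptens y z))).
  by move=> f g; split=> [y|u] c v w; rewrite !(ptensE, linearP).
pose G h z := sval (cid (gtens_lift_ex (bb h z))).
have GE h z f g u y : composable f g -> homog f u -> homog g y ->
    G h z (ptens u y) = uval (a f g h) *: ptens u (R (ptens y z)).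
  by rewrite /G; case: cid => /= H; apply.
have Gb : forall f h, bilin (fun (t : tot (gtens M N)) (z : tot P) => G h z t).
  move=> _ h; split=> [z|t]; first exact: linearP.
  move=> c x y; elim/gtens_ind: t => [|t t' Et Et'|f g u v fg fu gv].
  - by rewrite /= !raddf0 addr0.
  - by rewrite /= !linearD /= Et Et' addrACA.
  - by rewrite !(GE h _ f g) // !(ptensE, linearP).
have [F FE] := gtens_lift_ex Gb; exists F => f g h u y z fg gh fu gy hz.
rewrite (FE (g \oc f) h) //; [exact: GE|exact: composable_cmpl|].
exact: homog_ptens.
Qed.

Lemma homog_gmul (A : galgebra a) f g (x y : tot A) :
  composable f g -> homog f x -> homog g y -> homog (g \oc f) (gmul x y).
Proof. by move=> fg fx gy; apply: gmu_graded; exact: homog_ptens. Qed.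

Lemma galgebra_bimodule (A : galgebra a) :
  is_bimodule (A := A) (B := A) (gmu A) (gmu A).
Proof.
split.
- exact: gmu_graded.
- exact: gmu_graded.
- exact: gmuA.
- exact: gmuA.
- exact: gmuA.
- exact: gmu1l.
- exact: gmu1r.
Qed.

Variables (A A' B B' : galgebra a) (M N : gmod k C).
Variables (L : {linear tot (gtens A M) -> tot M}).
Variables (R' : {linear tot (gtens M B') -> tot M}).
Variables (L' : {linear tot (gtens A' N) -> tot N}).
Variables (R : {linear tot (gtens N B) -> tot N}).
Variables (F : {linear tot (gtens A (gtens M N)) -> tot (gtens M N)}).
Variables (G : {linear tot (gtens (gtens M N) B) -> tot (gtens M N)}).

(** On homogeneous pure tensors the two sides of each equational axiom are multiples of one tensor,
    once the axioms of the factors are applied. The scalars agree by [cocycleV_left], [cocycleE],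
    [cocycleV_mid], [cocycleV_unitl] and [cocycle_unitr], in the order of the axioms. *)
Lemma tens_bimodule : is_bimodule L R' -> is_bimodule L' R ->
  tens_left_spec L F -> tens_right_spec R G -> is_bimodule F G.
Proof.
move=> bM bN FE GE.
have hL f g x u := @homog_act _ _ _ L f g x u (rhoL_graded bM).
have hR f g x u := @homog_act _ _ _ R f g x u (rhoR_graded bN).
split.
- move=> g t; move: t; apply: homog_gtens_ind => [|x y|f h x m fh <- fx].
  + by rewrite linear0; exact: homog0.
  + by rewrite linearD; exact: homogD.
  move: m; apply: homog_gtens_ind => [|u v|f1 f2 u v c12 E fu fv].
  + by rewrite ptens0r linear0; exact: homog0.
  + by rewrite ptensDr linearD; exact: homogD.
  have c1 : composable f f1 by move: fh; rewrite -E (composable_cmpEr _ c12).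
  rewrite (FE f f1 f2) // -E -(composable_cmpA c1 c12); apply: homogZ.
  apply: homog_ptens => //; last exact: hL.
  exact: composable_cmpl.
- move=> g t; move: t; apply: homog_gtens_ind => [|x y|f h m x fh <- + hx].
  + by rewrite linear0; exact: homog0.
  + by rewrite linearD; exact: homogD.
  move: m; apply: homog_gtens_ind => [|u v|f1 f2 u v c12 E fu fv].
  + by rewrite ptens0l linear0; exact: homog0.
  + by rewrite ptensDl linearD; exact: homogD.
  have c2 : composable f2 h by move: fh; rewrite -E (composable_cmpEl _ c12).
  rewrite (GE f1 f2 h) // -E (composable_cmpA c12 c2); apply: homogZ.
  apply: homog_ptens => //; last exact: hR.
  exact: composable_cmpr.
- move=> f g h x y m fg gh fx gy; move: m.
  apply: homog_gtens_ind => [|u v|f1 f2 u v c12 E fu fv].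
  + by rewrite !(ptens0r, linear0).
  + by rewrite !(ptensDr, linearD) /= => -> ->.
  have c1 : composable g f1 by move: gh; rewrite -E (composable_cmpEr _ c12).
  rewrite (FE (g \oc f) f1 f2) //; first last.
    + exact: homog_gmul.
    + exact: composable_cmpl.
  rewrite (FE g f1 f2) // !ptensZr linearZ /=.
  rewrite (FE f (f1 \oc g) f2) //; first last.
    + exact: hL.
    + exact: composable_cmpl.
    + exact: composable_cmpr.
  rewrite (rhoL_mul bM (f := f) (g := g) (h := f1)) // ptensZl !scalerA.
  congr (_ *: _); rewrite mulrC -E cocycleV_left //; ring.
- move=> f g h m x y fg gh + gx hy; move: m.
  apply: homog_gtens_ind => [|u v|f1 f2 u v c12 E fu fv].
  + by rewrite !(ptens0l, linear0).
  + by rewrite !(ptensDl, linearD) /= => -> ->.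
  have c2 : composable f2 g by move: fg; rewrite -E (composable_cmpEl _ c12).
  rewrite (GE f1 f2 g) // ptensZl linearZ /=.
  rewrite (GE f1 (g \oc f2) h) //; first last.
    + exact: hR.
    + exact: composable_cmpl.
    + exact: composable_cmpr.
  rewrite (GE f1 f2 (h \oc g)) //; first last.
    + exact: homog_gmul.
    + exact: composable_cmpr.
  rewrite (rhoR_mul bN (f := f2) (g := g) (h := h)) // ptensZr !scalerA.
  by congr (_ *: _); rewrite cocycleE // E mulrC.
(* Each action touches its own factor, so both sides are multiples of [(x.u) (x) (v.y)]. *)
- move=> f g h x m y fg gh fx + hy; move: m.
  apply: homog_gtens_ind => [|u v|f1 f2 u v c12 E fu fv].
  + by rewrite !(ptens0l, ptens0r, linear0).
  + by rewrite !(ptensDl, ptensDr, linearD) /= => -> ->.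
  have c1 : composable f f1 by move: fg; rewrite -E (composable_cmpEr _ c12).
  have c2 : composable f2 h by move: gh; rewrite -E (composable_cmpEl _ c12).
  rewrite (FE f f1 f2) // ptensZl linearZ /=.
  rewrite (GE (f1 \oc f) f2 h) //; first last.
    + exact: hL.
    + exact: composable_cmpl.
  rewrite (GE f1 f2 h) // ptensZr [F _]linearZ /=.
  rewrite (FE f f1 (h \oc f2)) //; first last.
    + exact: hR.
    + exact: composable_cmpr.
  rewrite !scalerA; congr (_ *: _); rewrite mulrC -E cocycleV_mid //; ring.
- move=> g; apply: homog_gtens_ind => [|u v|f1 f2 u v c12 E fu fv].
  + by rewrite !(ptens0r, linear0).
  + by rewrite !(ptensDr, linearD) /= => -> ->.
  have Es : src g = src f1 by rewrite -E src_cmp //; exact/eqP.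
  have c1 : composable (idm (src f1)) f1 by rewrite /composable tgt_idm.
  rewrite Es (FE (idm (src f1)) f1 f2) //; last exact: gone_homog.
  rewrite (rhoL1 bM fu) ptensZl scalerA /unitorL; congr (_ *: _).
  by rewrite Es -E cocycleV_unitl.
- move=> g; apply: homog_gtens_ind => [|u v|f1 f2 u v c12 E fu fv].
  + by rewrite !(ptens0l, linear0).
  + by rewrite !(ptensDl, linearD) /= => -> ->.
  have Et : tgt g = tgt f2 by rewrite -E tgt_cmp //; exact/eqP.
  have c2 : composable f2 (idm (tgt f2)) by rewrite /composable src_idm.
  rewrite Et (GE f1 f2 (idm (tgt f2))) //; last exact: gone_homog.
  rewrite (rhoR1 bN fv) ptensZr scalerA /unitorR Et; congr (_ *: _).
  by rewrite -E cocycle_unitr.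
Qed.
End TensorBimodule.

(** * Homological direct sums *)

Section HomologicalSum.
Variables (k : comPzRingType) (C : small_category) (M : bigmod k C).
Implicit Types (f g h : mor C) (n : int).

Fact hinj_subproof n (t : tot (M n)) :
  finsupp_fun (fun g => dinj (t g) : hsum M g).
Proof.
apply/asboolP; have [s sP] := dsum_finsupp t; exists s => g /sP ->.
exact: raddf0.
Qed.
(** Inclusion of the summand of homological degree [n] for a general family; [bar_in] is its
    instance for the bar complex. *)
Definition hinj n (t : tot (M n)) : tot (hsum M) := DSum (hinj_subproof t).

Lemma hinj_is_linear n : linear (@hinj n).
Proof. by move=> c x y; apply: dsumP => g; rewrite /= linearP. Qed.
HB.instance Definition _ n :=
  GRing.isLinear.Build k (tot (M n)) (tot (hsum M)) *:%R (@hinj n)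
    (@hinj_is_linear n).

Lemma hinj_dinj n g (y : M n g) :
  hinj (dinj y : tot (M n)) = dinj (dinj y : hsum M g).
Proof.
apply: dsumP => h /=; have [gh|gh] := eqVneq g h.
  by subst h; rewrite !dfwith_in.
by rewrite !dfwith_out // raddf0.
Qed.

Lemma bihomogP n g (m : tot (hsum M)) :
  bihomog n g m <-> exists2 t : tot (M n), homog g t & m = hinj t.
Proof.
split=> [[y ->]|[_ [y ->] ->]]; last by exists y; rewrite hinj_dinj.
by exists (dinj y); rewrite ?hinj_dinj //; exists y.
Qed.

Lemma homog_hinj n g (t : tot (M n)) : homog g t -> homog g (hinj t).
Proof.
by move=> [y ->]; rewrite hinj_dinj; exists (@dinj k _ (fun i => M i g) n y).
Qed.

Lemma homog_hsum_ind g (P : tot (hsum M) -> Prop) :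
  P 0 -> (forall x y, P x -> P y -> P (x + y)) ->
  (forall n (t : tot (M n)), homog g t -> P (hinj t)) ->
  forall m, homog g m -> P m.
Proof.
move=> P0 PD Pt m [m' ->]; elim/dsum_ind: m' => [|x y Px Py|n y].
- by rewrite raddf0.
- by rewrite raddfD; exact: PD.
- by rewrite -hinj_dinj; apply: Pt; exists y.
Qed.

Lemma hsum_ind (P : tot (hsum M) -> Prop) :
  P 0 -> (forall x y, P x -> P y -> P (x + y)) ->
  (forall n (t : tot (M n)), P (hinj t)) -> forall m, P m.
Proof.
by move=> P0 PD Pt; apply: tot_ind => // g; apply: homog_hsum_ind.
Qed.

(** In [tot (hsum M)] the outer sum runs over morphisms and the inner one over homological degrees,
    so the maps [F n] are regrouped by morphism before lifting. *)
Lemma hsum_lift_ex (W : lmodType k) (F : forall n, {linear tot (M n) -> W}) :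
  exists G : {linear tot (hsum M) -> W},
    forall n (t : tot (M n)), G (hinj t) = F n t.
Proof.
pose phi g n : {linear M n g -> W} := F n \o @dinj k _ (M n) g.
pose psi g := sval (cid (dsum_lift_ex (phi g))).
have [G GE] := dsum_lift_ex psi; exists G => n t.
elim/dsum_ind: t => [|x y Ex Ey|g y].
- by rewrite !raddf0.
- by rewrite !linearD /= Ex Ey.
- by rewrite hinj_dinj GE /psi; case: cid => H /= ->.
Qed.

Lemma hsum_left_ex (P : gmod k C)
    (L : forall n, {linear tot (gtens P (M n)) -> tot (M n)}) :
  exists F : {linear tot (gtens P (hsum M)) -> tot (hsum M)},
    forall n x (t : tot (M n)), F (ptens x (hinj t)) = hinj (L n (ptens x t)).
Proof.
have lin x n : linear (fun t : tot (M n) => hinj (L n (ptens x t))).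
  by move=> c u v; rewrite !(ptensE, linearP).
pose G x := sval (cid (hsum_lift_ex (fun n => mklinear (lin x n)))).
have GE x n t : G x (hinj t) = hinj (L n (ptens x t)).
  by rewrite /G; case: cid => H /= ->.
have Gb : forall f h : mor C, bilin (fun x m => G x m).
  move=> _ _; split=> [m|x]; last exact: linearP.
  move=> c x y; elim/hsum_ind: m => [|u v Eu Ev|n t].
  - by rewrite /= !raddf0 addr0.
  - by rewrite /= !linearD /= Eu Ev addrACA.
  - by rewrite !GE !(ptensE, linearP).
have [F FE] := gtens_lift_ex Gb; exists F => n x t.
elim/tot_ind: x => [|u v Eu Ev|f x fx].
- by rewrite !(ptens0l, linear0).
- by rewrite !(ptensDl, linearD) /= Eu Ev.
elim/tot_ind: t => [|u v Eu Ev|g t gt].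
- by rewrite linear0 !(ptens0r, linear0).
- by rewrite linearD !(ptensDr, linearD) /= Eu Ev.
have gt' := homog_hinj gt.
have [fg|nfg] := boolP (composable f g); first by rewrite (FE f g) // GE.
(* The formula is claimed for all [x] and [t]; in non-composable degrees both sides are zero. *)
by rewrite !(ptens_noncomposable fx _ nfg) // !linear0.
Qed.

Lemma hsum_right_ex (P : gmod k C)
    (R : forall n, {linear tot (gtens (M n) P) -> tot (M n)}) :
  exists F : {linear tot (gtens (hsum M) P) -> tot (hsum M)},
    forall n x (t : tot (M n)), F (ptens (hinj t) x) = hinj (R n (ptens t x)).
Proof.
have lin x n : linear (fun t : tot (M n) => hinj (R n (ptens t x))).
  by move=> c u v; rewrite !(ptensE, linearP).
pose G x := sval (cid (hsum_lift_ex (fun n => mklinear (lin x n)))).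
have GE x n t : G x (hinj t) = hinj (R n (ptens t x)).
  by rewrite /G; case: cid => H /= ->.
have Gb : forall f h : mor C, bilin (fun m x => G x m).
  move=> _ _; split=> [x|m]; first exact: linearP.
  move=> c x y; elim/hsum_ind: m => [|u v Eu Ev|n t].
  - by rewrite /= !raddf0 addr0.
  - by rewrite /= !linearD /= Eu Ev addrACA.
  - by rewrite !GE !(ptensE, linearP).
have [F FE] := gtens_lift_ex Gb; exists F => n x t.
elim/tot_ind: x => [|u v Eu Ev|f x fx].
- by rewrite !(ptens0r, linear0).
- by rewrite !(ptensDr, linearD) /= Eu Ev.
elim/tot_ind: t => [|u v Eu Ev|g t gt].
- by rewrite linear0 !(ptens0l, linear0).
- by rewrite linearD !(ptensDl, linearD) /= Eu Ev.
have gt' := homog_hinj gt.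
have [gf|ngf] := boolP (composable g f); first by rewrite (FE g f) // GE.
rewrite (ptens_noncomposable gt' fx) // (ptens_noncomposable gt fx) //.
by rewrite !linear0.
Qed.

Variables (a : grading k C) (A B : galgebra a).
Variables (L : forall n, {linear tot (gtens A (M n)) -> tot (M n)}).
Variables (R : forall n, {linear tot (gtens (M n) B) -> tot (M n)}).
Variables (F : {linear tot (gtens A (hsum M)) -> tot (hsum M)}).
Variables (G : {linear tot (gtens (hsum M) B) -> tot (hsum M)}).

(** The axioms are preserved by sums in the module element, hence can be checked on one summand,
    where [hinj] commutes with the actions. *)
Lemma hsum_bimodule :
  (forall n x (t : tot (M n)), F (ptens x (hinj t)) = hinj (L n (ptens x t))) ->
  (forall n x (t : tot (M n)), G (ptens (hinj t) x) = hinj (R n (ptens t x))) ->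
  (forall n, is_bimodule (L n) (R n)) -> is_bimodule F G.
Proof.
move=> FE GE bLR; split.
- move=> g t; move: t; apply: homog_gtens_ind => [|x y|f h x m fh <- fx].
  + by rewrite linear0; exact: homog0.
  + by rewrite linearD; exact: homogD.
  move: m; apply: homog_hsum_ind => [|u v|n t ht].
  + by rewrite ptens0r linear0; exact: homog0.
  + by rewrite ptensDr linearD; exact: homogD.
  by rewrite FE; apply/homog_hinj/(rhoL_graded (bLR n))/homog_ptens.
- move=> g t; move: t; apply: homog_gtens_ind => [|x y|f h m x fh <- + hx].
  + by rewrite linear0; exact: homog0.
  + by rewrite linearD; exact: homogD.
  move: m; apply: homog_hsum_ind => [|u v|n t ht].
  + by rewrite ptens0l linear0; exact: homog0.
  + by rewrite ptensDl linearD; exact: homogD.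
  by rewrite GE; apply/homog_hinj/(rhoR_graded (bLR n))/homog_ptens.
- move=> f g h x y m fg gh fx gy; move: m.
  apply: homog_hsum_ind => [|u v|n t ht].
  + by rewrite !(ptens0r, linear0).
  + by rewrite !(ptensDr, linearD) /= => -> ->.
  by rewrite !FE -linearZ (rhoL_mul (bLR n) fg gh).
- move=> f g h m x y fg gh + gx hy; move: m.
  apply: homog_hsum_ind => [|u v|n t ht].
  + by rewrite !(ptens0l, linear0).
  + by rewrite !(ptensDl, linearD) /= => -> ->.
  by rewrite !GE -linearZ (rhoR_mul (bLR n) fg gh).
- move=> f g h x m y fg gh fx + hy; move: m.
  apply: homog_hsum_ind => [|u v|n t ht].
  + by rewrite !(ptens0l, ptens0r, linear0).
  + by rewrite !(ptensDl, ptensDr, linearD) /= => -> ->.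
  by rewrite FE !GE FE -linearZ (rhoLR (bLR n) fg gh).
- move=> g; apply: homog_hsum_ind => [|u v|n t ht].
  + by rewrite !(ptens0r, linear0).
  + by rewrite !(ptensDr, linearD) /= => -> ->.
  by rewrite FE -linearZ (rhoL1 (bLR n) ht).
- move=> g; apply: homog_hsum_ind => [|u v|n t ht].
  + by rewrite !(ptens0l, linear0).
  + by rewrite !(ptensDl, linearD) /= => -> ->.
  by rewrite GE -linearZ (rhoR1 (bLR n) ht).
Qed.

End HomologicalSum.

(** * Tensor powers and the bar differential *)

Section TensorPowers.
Variables (k : comPzRingType) (C : small_category) (a : grading k C).
Variable A : galgebra a.
Implicit Types (f g h : mor C) (n : nat).

Fixpoint tpowL n : {linear tot (gtens A (tpow A n)) -> tot (tpow A n)} :=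
  match n with
  | 0%N => gmu A
  | n'.+1 => sval (cid (tens_left_ex a A (tpowL n')))
  end.

(** No recursion here: the right action only multiplies the last tensor factor, so from [n = 1] on
    it comes directly from [gmu A]. *)
Definition tpowR n : {linear tot (gtens (tpow A n) A) -> tot (tpow A n)} :=
  match n with
  | 0%N => gmu A
  | n'.+1 => sval (cid (tens_right_ex a (tpow A n') (gmu A)))
  end.

Arguments tpowL : simpl never.
Arguments tpowR : simpl never.

Lemma tpow_ind n (P : tot (tpow A n.+1) -> Prop) :
  P 0 -> (forall x y, P x -> P y -> P (x + y)) ->
  (forall f h (x : tot (tpow A n)) (y : tot A), composable f h ->
    homog f x -> homog h y -> P (ptens x y)) ->
  forall t, P t.
Proof. exact: gtens_ind. Qed.

Lemma tpowLE n f g h (x : tot A) (u : tot (tpow A n)) (y : tot A) :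
  composable f g -> composable g h ->
  homog f x -> homog g u -> homog h y ->
  tpowL n.+1 (ptens x (ptens u y : tot (tpow A n.+1))) =
  uinv (a f g h) *: (ptens (tpowL n (ptens x u)) y : tot (tpow A n.+1)).
Proof. rewrite /tpowL /tpowR; case: cid => F /=; exact. Qed.

Lemma tpowRE n f g h (u : tot (tpow A n)) (y z : tot A) :
  composable f g -> composable g h ->
  homog f u -> homog g y -> homog h z ->
  tpowR n.+1 (ptens (ptens u y : tot (tpow A n.+1)) z) =
  uval (a f g h) *: (ptens u (gmul y z) : tot (tpow A n.+1)).
Proof. rewrite /tpowL /tpowR; case: cid => F /=; exact. Qed.

(** Inductively [tpow A n.+1] is the tensor product of the bimodules [tpow A n] and [A]. *)
Lemma tpow_bimodule n : is_bimodule (tpowL n) (tpowR n).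
Proof.
elim: n => [|n IHn]; first exact: galgebra_bimodule.
rewrite /tpowL /tpowR; apply: (tens_bimodule IHn (galgebra_bimodule A)).
  by case: cid.
by case: cid.
Qed.

(** * Tensoring a map with the identity, and the bar differential on tensor powers *)

Section TensMap.
Variables (M M' N : gmod k C) (F : {linear tot M -> tot M'}).

Fact tens_map_bilin (f g : mor C) :
  bilin (fun (u : tot M) (y : tot N) => ptens (F u) y).
Proof. by split=> [y|u] c v w; rewrite !(ptensE, linearP). Qed.

Definition tens_map := sval (cid (gtens_lift_ex tens_map_bilin)).

(** Gradedness of [F] makes the formula valid for all [u] and [y]: a product that vanishes because
    degrees do not compose still vanishes after [F]. *)
Lemma tens_mapE (Fgr : graded_map F) u y : tens_map (ptens u y) = ptens (F u) y.
Proof.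
rewrite /tens_map; case: cid => G /= GE.
elim/tot_ind: u => [|u v Eu Ev|f u fu].
- by rewrite !(ptens0l, linear0).
- by rewrite !(ptensDl, linearD) /= Eu Ev.
elim/tot_ind: y => [|y z Ey Ez|g y gy].
- by rewrite !(ptens0r, linear0).
- by rewrite !(ptensDr, linearD) /= Ey Ez.
have [fg|nfg] := boolP (composable f g); first exact: (GE f g).
rewrite (ptens_noncomposable fu gy nfg) linear0.
by rewrite (ptens_noncomposable (Fgr _ _ fu) gy nfg).
Qed.

Lemma tens_map_graded : graded_map F -> graded_map tens_map.
Proof.
move=> Fgr g; apply: homog_gtens_ind => [|u v|f h u y fh <- fu hy].
- by rewrite linear0; exact: homog0.
- by rewrite linearD; exact: homogD.
- by rewrite tens_mapE //; apply: homog_ptens => //; exact: Fgr.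
Qed.

End TensMap.

(* For [n > 0] this is the bar differential out of homological degree [n]; for
   [n = 0] it is the augmentation, where the bar complex itself has [0]. *)
Fixpoint tdiff n : {linear tot (tpow A n.+1) -> tot (tpow A n)} :=
  match n with
  | 0%N => gmu A
  | n'.+1 => tens_map A (tdiff n') \+ ((-1) ^+ n'.+1 : k) \*: tpowR n'.+1
  end.

Arguments tdiff : simpl never.

Lemma tdiff_graded n : graded_map (tdiff n).
Proof.
elim: n => [|n IHn]; first exact: gmu_graded.
move=> g t gt; apply: homogD; first exact: tens_map_graded.
by apply: homogZ; exact: (rhoR_graded (tpow_bimodule n.+1)).
Qed.

Lemma tdiffE n (u : tot (tpow A n.+1)) (y : tot A) :
  tdiff n.+1 (ptens u y) =
  ptens (tdiff n u) y + (-1) ^+ n.+1 *: tpowR n.+1 (ptens u y).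
Proof. by rewrite -(tens_mapE (@tdiff_graded n)). Qed.

Lemma tdiff0 t : tdiff 0 t = gmu A t. Proof. by []. Qed.

(** On [u (x) y] the summand [d (x) id] leaves the last factor alone, and for the last face the
    claim is associativity of the right action. No induction on [n] is involved; at [n = 0] the
    claim is associativity of [gmu A]. *)
Lemma tdiff_rmul n (t : tot (tpow A n.+1)) (z : tot A) :
  tdiff n (tpowR n.+1 (ptens t z)) = tpowR n (ptens (tdiff n t) z).
Proof.
elim/tot_ind: z => [|z w Ez Ew|h z hz].
- by rewrite !(ptens0r, linear0).
- by rewrite !(ptensDr, linearD) /= Ez Ew.
move: t; apply: tpow_ind => [|t t' Et Et'|f g u y fg fu gy].
- by rewrite !(ptens0l, linear0).
- by rewrite !(ptensDl, linearD) Et Et'.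
have uy := homog_ptens fg fu gy.
have [gh|ngh] := boolP (composable g h); last first.
  have nh : ~~ composable (g \oc f) h by rewrite composable_cmpEl.
  rewrite (ptens_noncomposable uy hz nh).
  by rewrite (ptens_noncomposable (tdiff_graded uy) hz nh) !linear0.
rewrite (tpowRE fg gh) // linearZ.
case: n u fu uy => [|n] u fu uy.
  by rewrite !tdiff0 [RHS](gmuA fg gh fu gy hz).
rewrite 2!tdiffE ptensDl !linearD /=.
rewrite scalerDr; congr (_ + _).
  exact/esym/(tpowRE fg gh (tdiff_graded fu) gy hz).
rewrite ptensZl !linearZ /=; congr (_ *: _).
exact/esym/(rhoR_mul (tpow_bimodule n.+1) fg gh fu gy hz).
Qed.

(** By induction: the summand [d (x) id] is handled by the hypothesis for [d], and the last face by
    the commutation of the left and right actions. *)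
Lemma tdiff_lmul n (x : tot A) (t : tot (tpow A n.+1)) :
  tdiff n (tpowL n.+1 (ptens x t)) = tpowL n (ptens x (tdiff n t)).
Proof.
(* Reduction to homogeneous pure tensors of composable degrees, shared by the base case and the
   induction step. *)
have reduce m : (forall f g h (x : tot A) (u : tot (tpow A m)) (y : tot A),
    composable f g -> composable g h -> homog f x -> homog g u -> homog h y ->
    tdiff m (tpowL m.+1 (ptens x (ptens u y : tot (tpow A m.+1)))) =
    tpowL m (ptens x (tdiff m (ptens u y)))) ->
  forall x (s : tot (tpow A m.+1)),
    tdiff m (tpowL m.+1 (ptens x s)) = tpowL m (ptens x (tdiff m s)).
  move=> pure {}x; elim/tot_ind: x => [|x w Ex Ew|f x fx] s.
  - by rewrite !(ptens0l, linear0).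
  - by rewrite !(ptensDl, linearD) /= Ex Ew.
  move: s; apply: tpow_ind => [|s s' Es Es'|g h u y gh gu hy].
  - by rewrite !(ptens0r, linear0).
  - by rewrite !(ptensDr, linearD) Es Es'.
  have [fg|nfg] := boolP (composable f g); first exact: (pure f g h).
  have nh : ~~ composable f (h \oc g) by rewrite composable_cmpEr.
  have uy := homog_ptens gh gu hy.
  rewrite (ptens_noncomposable fx uy nh).
  by rewrite (ptens_noncomposable fx (tdiff_graded uy) nh) !linear0.
elim: n x t => [|n IHn]; apply: reduce => f g h x u y fg gh fx gu hy.
  rewrite (@tpowLE 0 f g h) // [LHS]linearZ.
  (* Inserting [alpha^-1 alpha] on the right turns the base case into associativity of [gmu A]. *)
  rewrite -[RHS]scale1r -(uvalK (a f g h)) mulrC -scalerA.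
  by congr (_ *: _); exact: (gmuA fg gh fx gu hy).
apply: etrans (congr1 (tdiff n.+1) (@tpowLE n.+1 f g h x u y fg gh fx gu hy)) _.
rewrite [LHS]linearZ.
rewrite 2!tdiffE IHn ptensDr linearD [LHS]/= scalerDr.
congr (_ + _); first exact/esym/(tpowLE fg gh fx (tdiff_graded gu) hy).
rewrite ptensZr [RHS]linearZ /= scalerA mulrC -scalerA; congr (_ *: _).
(* The factor [alpha] from commuting the actions cancels the [alpha^-1] of the left action on
   [u (x) y]. *)
rewrite (rhoLR (tpow_bimodule n.+1) fg gh fx gu hy).
by rewrite scalerA mulrC uvalK scale1r.
Qed.

Lemma tdiff_tdiff n (t : tot (tpow A n.+2)) : tdiff n (tdiff n.+1 t) = 0.
Proof.
have reduce m : (forall (u : tot (tpow A m.+1)) (y : tot A),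
    tdiff m (tdiff m.+1 (ptens u y)) = 0) ->
  forall s : tot (tpow A m.+2), tdiff m (tdiff m.+1 s) = 0.
  move=> pure; apply: tpow_ind => [|x y Ex Ey|//]; first by rewrite !linear0.
  rewrite (raddfD (tdiff m.+1)) [LHS]raddfD.
  by apply: etrans (congr2 +%R Ex Ey) _; rewrite addr0.
elim: n t => [|n IHn]; apply: reduce => u y.
  apply: etrans (congr1 (tdiff 0) (tdiffE u y)) _.
  rewrite [LHS]linearD [X in _ + X]linearZ expr1 [X in _ + X]scaleN1r.
  (* The two composites to [A] agree by right linearity of the augmentation [tdiff A 0]. *)
  by apply/eqP; rewrite subr_eq0 tdiff_rmul.
apply: etrans (congr1 (tdiff n.+1) (tdiffE u y)) _.
rewrite [LHS]linearD [X in _ + X]linearZ [X in _ + _ X]tdiff_rmul.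
apply: etrans (congr2 +%R (tdiffE _ _) (erefl _)) _.
(* What remains is the right action on [du (x) y] twice, with the consecutive signs of the last
   faces in degrees [n.+1] and [n.+2], which are opposite. *)
rewrite IHn ptens0l add0r.
by rewrite [X in _ + X]/= -scalerDl [in X in _ + X]exprS mulN1r addrN scale0r.
Qed.

End TensorPowers.

(** * The bar construction *)

Section PureTensors.
Variables (k : comPzRingType) (C : small_category) (a : grading k C).
Variable A : galgebra a.
Implicit Types (g : nat -> mor C) (h : mor C) (x : nat -> tot A) (y z : tot A).

Lemma homog_chainW n g x : homog_chain n.+1 g x -> homog_chain n g x.
Proof.
by move=> [gx gg]; split=> i ni; [apply: gx|apply: gg]; exact: leqW.
Qed.

Lemma tgt_degs n g x : homog_chain n g x -> tgt (degs g n) = tgt (g n).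
Proof.
elim: n => [//|n IHn] gx /=; have gx' := homog_chainW gx.
by rewrite tgt_cmp ?IHn //; apply/eqP; exact: gx.2.
Qed.

Lemma composable_degs n g x h :
  homog_chain n g x -> composable (degs g n) h = composable (g n) h.
Proof. by move=> gx; rewrite /composable (tgt_degs gx). Qed.

Lemma src_degs n g x : homog_chain n g x -> src (degs g n) = src (g 0%N).
Proof.
elim: n => [//|n IHn] gx /=; have gx' := homog_chainW gx.
by rewrite src_cmp ?IHn // (tgt_degs gx'); apply/eqP; exact: gx.2.
Qed.

Lemma homog_tpow_pure n g x :
  homog_chain n g x -> homog (degs g n) (tpow_pure n x).
Proof.
elim: n => [|n IHn] gx; first exact: gx.1.
have gx' := homog_chainW gx.
apply: homog_ptens; [|exact: IHn|exact: gx.1].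
by rewrite (composable_degs _ gx') gx.2.
Qed.

Lemma eq_tpow_pure n x x' :
  (forall i, (i <= n)%N -> x i = x' i) -> tpow_pure n x = tpow_pure n x'.
Proof.
elim: n => [|n IHn] xx; first exact: xx.
rewrite /= xx // IHn // => i ni; apply: xx; exact: leqW.
Qed.

(** Every tensor factor after the first contributes one inverse associator; at [n.+1] the product is
    [bar_Phi a n h g]. *)
Lemma tpowL_pure n h g y x :
  homog_chain n g x -> homog h y -> composable h (g 0%N) ->
  tpowL A n (ptens y (tpow_pure n x)) =
  (\prod_(1 <= i < n.+1) uinv (a h (degs g i.-1) (g i))) *:
    tpow_pure n (set_at 0 (gmul y (x 0%N)) x).
Proof.
move=> + hy hg; elim: n => [|n IHn] gx; first by rewrite big_geq // scale1r.
have gx' := homog_chainW gx.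
have hd : composable h (degs g n) by rewrite /composable (src_degs gx').
have dg : composable (degs g n) (g n.+1).
  by rewrite (composable_degs _ gx') gx.2.
apply: etrans (tpowLE hd dg hy (homog_tpow_pure gx') (gx.1 _ (leqnn _))) _.
rewrite (IHn gx') ptensZl scalerA [in RHS]big_nat_recr //=.
by congr (_ *: _); rewrite mulrC.
Qed.

(** The scalar is [bar_Psi a n g h]: one step of the tensor recursion suffices. *)
Lemma tpowR_pure n g h x z :
  homog_chain n.+1 g x -> homog h z -> composable (g n.+1) h ->
  tpowR A n.+1 (ptens (tpow_pure n.+1 x) z) =
  uval (a (degs g n) (g n.+1) h) *:
    tpow_pure n.+1 (set_at n.+1 (gmul (x n.+1) z) x).
Proof.
move=> gx hz gh; have gx' := homog_chainW gx.
have dg : composable (degs g n) (g n.+1).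
  by rewrite (composable_degs _ gx') gx.2.
apply: etrans (tpowRE dg gh (homog_tpow_pure gx') (gx.1 _ (leqnn _)) hz) _.
congr (_ *: _); rewrite /= {2}/set_at eqxx; congr (ptens _ _).
by apply: eq_tpow_pure => i ni; rewrite /set_at ltn_eqF.
Qed.

(** Unrolls the recursion for [tdiff] into the alternating sum of faces: [d (x) id] yields all faces
    but the last, and the right action yields the last. *)
Lemma tdiff_pure n g x : homog_chain n.+1 g x ->
  tdiff A n (tpow_pure n.+1 x) =
  \sum_(0 <= i < n.+1)
    ((-1) ^+ i * bar_face_coef a g i) *: tpow_pure n (merge_at i x).
Proof.
elim: n => [|n IHn] gx; first by rewrite big_nat1 expr0 mul1r scale1r.
have gx' := homog_chainW gx.
apply: etrans (tdiffE _ _) _; rewrite big_nat_recr // IHn //.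
congr (_ + _); last first.
  (* [set_at] and [merge_at] differ only beyond index [n.+1], which [tpow_pure n.+1] does not
     read. *)
  rewrite (tpowR_pure gx' (gx.1 n.+2 (leqnn _)) (gx.2 n.+1 (leqnn _))).
  rewrite scalerA; congr (_ *: _); apply: eq_tpow_pure => i.
  rewrite leq_eqVlt => /orP[/eqP->|]; rewrite /set_at /merge_at.
    by rewrite eqxx ltnn.
  by move=> ni; rewrite ltn_eqF // ni.
have sumE (r : seq nat) (F : nat -> tot (tpow A n)) y :
    ptens (\sum_(i <- r) F i) y = \sum_(i <- r) ptens (F i) y.
  by elim/big_rec2: _ => [|i u v _ <-]; rewrite ?ptens0l ?ptensDl.
rewrite sumE; apply: eq_big_nat => i /andP[_ ni].
rewrite ptensZl /=; congr (_ *: ptens _ _).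
(* The merge happens at [i < n.+1], so the shift puts [x n.+2] in the last position [n.+1]. *)
by rewrite /merge_at ltnNge (ltnW ni) /= gtn_eqF.
Qed.

End PureTensors.

(** * Assembling the homological degrees into the bar complex *)

Section BarModule.
Variables (k : comPzRingType) (C : small_category) (a : grading k C).
Variable A : galgebra a.

Definition zero_linear (U V : lmodType k) : {linear U -> V} := \0.

Definition barL (n : int) : {linear tot (gtens A (bar A n)) -> tot (bar A n)} :=
  match n return {linear tot (gtens A (bar A n)) -> tot (bar A n)} with
  | Posz n' => tpowL A n'.+1
  | Negz n' => zero_linear _ _
  end.

Definition barR (n : int) : {linear tot (gtens (bar A n) A) -> tot (bar A n)} :=
  match n return {linear tot (gtens (bar A n) A) -> tot (bar A n)} with
  | Posz n' => tpowR A n'.+1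
  | Negz n' => zero_linear _ _
  end.

(** [hinj] in degree [n] with its source written as [tpow A n.+1], to which [bar A (Posz n)] is
    convertible. *)
Definition bar_incl (n : nat) :
    {linear tot (tpow A n.+1) -> tot (hsum (bar A))} :=
  mklinear (@hinj_is_linear k C (bar A) (Posz n)).

(** In homological degree 0 the augmentation [tdiff A 0] is replaced by zero. *)
Definition bar_diff_at (n : int) :
    {linear tot (bar A n) -> tot (hsum (bar A))} :=
  match n return {linear tot (bar A n) -> tot (hsum (bar A))} with
  | Posz 0%N => zero_linear _ _
  | Posz n'.+1 => mklinear (linearP (bar_incl n' \o tdiff A n'.+1))
  | Negz n' => zero_linear _ _
  end.

Lemma bar_neg0 n (t : tot (bar A (Negz n))) : t = 0.
Proof. by apply: dsumP => g; exact: thinmx0. Qed.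

Lemma bar_bimodule n : is_bimodule (barL n) (barR n).
Proof.
case: n => n; first exact (tpow_bimodule A n.+1).
split.
- by move=> g t _; rewrite [X in homog _ X]bar_neg0; exact: homog0.
- by move=> g t _; rewrite [X in homog _ X]bar_neg0; exact: homog0.
all: by move=> *; rewrite [LHS]bar_neg0 [RHS]bar_neg0.
Qed.

Lemma bar_inE n (t : tot (tpow A n.+1)) : bar_in t = bar_incl n t.
Proof. exact: dsumP. Qed.

End BarModule.

Theorem proposition2p19 (k : comPzRingType) (C : small_category)
    (a : grading k C) (A : galgebra a) :
  exists (d : {linear tot (hsum (bar A)) -> tot (hsum (bar A))})
         (rhoL : {linear tot (gtens A (hsum (bar A))) -> tot (hsum (bar A))})
         (rhoR : {linear tot (gtens (hsum (bar A)) A) -> tot (hsum (bar A))}),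
    [/\ bar_diff_spec d, bar_left_spec rhoL, bar_right_spec rhoR
      & is_dg_bimodule rhoL rhoR d].
Proof.
have [d dE] := hsum_lift_ex (bar_diff_at A).
have [rL LE] := hsum_left_ex (barL A).
have [rR RE] := hsum_right_ex (barR A).
(* The defining equations in non-negative degrees, restated through [bar_incl] so that they rewrite
   on tensor powers. *)
have d0 t : d (bar_incl A 0 t) = 0 by exact: (dE (Posz 0) t).
have dS n t : d (bar_incl A n.+1 t) = bar_incl A n (tdiff A n.+1 t).
  exact: (dE (Posz n.+1) t).
have LS n x t : rL (ptens x (bar_incl A n t)) =
    bar_incl A n (tpowL A n.+1 (ptens x t)).
  exact: (LE (Posz n) x t).
have RS n x t : rR (ptens (bar_incl A n t) x) =
    bar_incl A n (tpowR A n.+1 (ptens t x)).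
  exact: (RE (Posz n) x t).
(* The summands of negative degree are zero, so the tensor powers span the whole module. *)
have incl_ind (P : tot (hsum (bar A)) -> Prop) : P 0 ->
    (forall x y, P x -> P y -> P (x + y)) ->
    (forall n t, P (bar_incl A n t)) -> forall m, P m.
  move=> P0 PD Pt; apply: hsum_ind => // -[n|n] t; first exact: Pt.
  by rewrite (bar_neg0 t) raddf0.
exists d, rL, rR; split.
- split=> [g x _|n g x gx]; first by rewrite /bar_pure bar_inE d0.
  rewrite /bar_pure bar_inE dS (tdiff_pure gx) raddf_sum.
  by apply: eq_bigr => i _; rewrite bar_inE; exact: linearZ.
- move=> n h g y x gx hy hg; rewrite /bar_pure !bar_inE LS.
  by rewrite (tpowL_pure gx hy hg); exact: linearZ.
- move=> n g h x y gx hy gh; rewrite /bar_pure !bar_inE RS.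
  by rewrite (tpowR_pure gx hy gh); exact: linearZ.
split.
- exact: (hsum_bimodule LE RE (@bar_bimodule _ _ _ A)).
- move=> n f g x m fg fx /bihomogP[t gt ->]; rewrite LE; apply/bihomogP.
  exists (barL A n (ptens x t)) => //.
  by apply: (rhoL_graded (bar_bimodule A n)); exact: homog_ptens.
- move=> n f g m x fg /bihomogP[t ft ->] gx; rewrite RE; apply/bihomogP.
  exists (barR A n (ptens t x)) => //.
  by apply: (rhoR_graded (bar_bimodule A n)); exact: homog_ptens.
- move=> n g m /bihomogP[t gt ->]; rewrite dE; apply/bihomogP.
  (* In degree 0 and in negative degrees the image is zero, which is homogeneous of every degree. *)
  case: n t gt => [[|n]|n] t gt /=.
  + by exists 0; [exact: homog0|rewrite raddf0].
  + have -> : n.+1%:Z - 1 = n%:Z by rewrite -addn1 PoszD addrK.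
    by exists (tdiff A n.+1 t) => //; exact: tdiff_graded.
  + by exists 0; [exact: homog0|rewrite raddf0].
- move=> x; apply: incl_ind => [|m m' Em Em'|n t].
  + by rewrite !(ptens0r, linear0).
  + by rewrite !(ptensDr, linearD) /= Em Em'.
  (* In degree 0 both sides vanish with [d]; above it the claim is [tdiff_lmul]. *)
  rewrite LS; case: n t => [|n] t; first by rewrite !d0 ptens0r linear0.
  by rewrite !dS LS tdiff_lmul.
- move=> m x; move: m; apply: incl_ind => [|m m' Em Em'|n t].
  + by rewrite !(ptens0l, linear0).
  + by rewrite !(ptensDl, linearD) /= Em Em'.
  rewrite RS; case: n t => [|n] t; first by rewrite !d0 ptens0l linear0.
  by rewrite !dS RS tdiff_rmul.
- apply: incl_ind => [|m m' Em Em'|[|n] t].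
  + by rewrite !linear0.
  + by rewrite !linearD /= Em Em' addr0.
  + by rewrite d0 linear0.
  (* From degree 1 the second differential is zero by definition; from higher degrees [tdiff_tdiff]
     applies. *)
  rewrite dS; case: n t => [|n] t; first exact: d0.
  by rewrite dS tdiff_tdiff linear0.
Qed.
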